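(* Let $G$ be a graph and let $f$ be a vertex-arithmetic IASI of $G$. Then $f$ is an arithmetic IASI of $G$ if and only if for any two adjacent vertices $u,v$ of $G$, the deterministic index of one of them, say $v$, equals $k$ times the deterministic index of the other, $u$, for some positive integer $k$ with $k\le |f(u)|$.
   Context: All graphs are simple, finite and have no isolated vertices. $\mathbb{N}_0$ is the set of non-negative integers; all sets considered are finite. For $A,B\subseteq\mathbb{N}_0$, $A+B=\{a+b: a\in A, b\in B\}$. An integer additive set-indexer (IASI) of $G$ is an injective function $f:V(G)\to 2^{\mathbb{N}_0}$ such that the induced function $f^+:E(G)\to 2^{\mathbb{N}_0}$, $f^+(uv)=f(u)+f(v)$, is also injective. An AP-set is a finite set of non-negative integers whose elements, in increasing order, form an arithmetic progression; its common difference is called the deterministic index of the element (vertex or edge) it labels. An IASI $f$ is vertex-arithmetic if $f(v)$ is an AP-set for every vertex $v$, edge-arithmetic if $f^+(e)$ is an AP-set for every edge $e$, and an arithmetic IASI if it is both. *)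

(* Defs.v *)
From mathcomp Require Import all_boot all_order finmap.

Set Implicit Arguments.
Unset Strict Implicit.
Unset Printing Implicit Defensive.

Local Open Scope fset_scope.

Record graph := Graph {
  vertex :> finType;
  adj : rel vertex;
  adj_sym : symmetric adj;
  adj_irrefl : irreflexive adj;
  no_isolated : forall v, exists u, adj v u
}.

Definition sumset (A B : {fset nat}) : {fset nat} :=
  [fset (a + b)%N | a in A, b in B].

(* The elements of A, in increasing order, are an arithmetic progression with
   common difference d. This determines d as soon as A has two elements (see
   det_index_uniq); a set with at most one element is an arithmetic
   progression, and every d is a common difference of it. *)
Definition det_index (A : {fset nat}) (d : nat) : Prop :=
  sorted (fun x y => y == (x + d)%N) (sort leq A).

Definition AP_set (A : {fset nat}) : Prop := exists d, det_index A d.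

Lemma det_index_uniq (A : {fset nat}) (d d' : nat) :
  (1 < #|` A|)%N -> det_index A d -> det_index A d' -> d = d'.
Proof.
rewrite /det_index -(size_sort leq).
case: (sort leq A) => [|x [|y s]] //= _ /andP[/eqP-> _] /andP[/eqP + _].
exact: addnI.
Qed.

Section IASI.
Variables (G : graph) (f : G -> {fset nat}).

Definition edge_label (u v : G) : {fset nat} := sumset (f u) (f v).

(* The second clause is the injectivity of f^+ on the edges of G, an edge
   being the unordered pair of its ends. *)
Definition IASI : Prop :=
  injective f /\
  forall u v x y : G, adj u v -> adj x y ->
    edge_label u v = edge_label x y -> [set u; v] = [set x; y].

Definition vertex_arithmetic_IASI : Prop :=
  IASI /\ forall v : G, AP_set (f v).

Definition edge_arithmetic_IASI : Prop :=
  IASI /\ forall u v : G, adj u v -> AP_set (edge_label u v).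

Definition arithmetic_IASI : Prop :=
  vertex_arithmetic_IASI /\ edge_arithmetic_IASI.

Definition index_multiple (u v : G) : Prop :=
  exists du dv k : nat,
    [/\ det_index (f u) du, det_index (f v) dv,
        (0 < k)%N, (k <= #|` f u|)%N & dv = (k * du)%N].

End IASI.

(* Main.v *)
Require Import Defs.
From mathcomp Require Import all_boot all_order finmap zify.

(** Write the labels of two adjacent vertices as [a + d i] ([i < m]) and
    [b + e j] ([j < n]) with [d <= e]. If [m, n >= 2] and the sumset is a
    progression, its two smallest elements are [a + b] and [a + b + d], so its
    difference is [d]; as it contains [a + b + e], this forces [e = k d], and
    if [k > m] the term [a + b + m d] would be missing. Conversely, if
    [k <= m], the numbers [i + k j] fill a whole interval. A label with at most
    one element admits every difference, hence also that of its neighbour. *)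

Section ArithmeticProgressions.

Implicit Types (A B : {fset nat}) (a b d e k m n : nat).

(** Here [n] counts indices, not elements: for [d = 0] repeated terms are allowed. Membership by
    index is what makes sumsets computable. *)
Definition progression A a d n : Prop :=
  forall x, x \in A <-> exists2 i, i < n & x = a + d * i.

Lemma path_mkseq d x s :
  path (fun y z => z == y + d) x s ->
  x :: s = mkseq (fun i => x + d * i) (size s).+1.
Proof.
elim: s x => [|y s IHs] x /=; first by rewrite /mkseq /= muln0 addn0.
case/andP=> /eqP-> /IHs ->; rewrite /mkseq /=.
congr [:: _, _ & _]; try lia.
rewrite -[2]/(1 + 1) iotaDl -!map_comp; apply: eq_map => i /=; lia.
Qed.

Lemma det_index_progression {A d} :
  det_index A d -> exists a, progression A a d #|` A|.
Proof.
rewrite /det_index => A_d.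
have [a sortA] :
    exists a, sort leq A = mkseq (fun i => a + d * i) #|` A|.
  rewrite -(size_sort leq); case: (sort leq A) A_d => [|x s] /=.
    by exists 0.
  by move/path_mkseq=> ->; exists x.
exists a => x; rewrite -[x \in A](mem_sort leq) sortA.
split=> [/mapP[i]|[i]].
  by rewrite mem_iota => lt_i ->; exists i.
by move=> lt_i ->; apply/mapP; exists i; rewrite ?mem_iota.
Qed.

Lemma det_index_gt0 {A d} : det_index A d -> 1 < #|` A| -> 0 < d.
Proof.
rewrite /det_index -(size_sort leq).
have: uniq (sort leq A) by rewrite sort_uniq fset_uniq.
case: (sort leq A) => [|x [|y s]] //=; rewrite inE negb_or.
by case/andP=> /andP[neq_xy _] _ /andP[/eqP def_y _] _; lia.
Qed.

(** The condition on [d] and [n] makes the [n] terms distinct, so listing them by index gives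
    exactly [sort leq A]. *)
Lemma progression_det_index A a d n :
  0 < d \/ n <= 1 -> progression A a d n -> det_index A d.
Proof.
move=> d_n A_prog.
have sorted_terms (r : rel nat) :
    (forall i, r (a + d * i) (a + d * i.+1)) ->
    sorted r (mkseq (fun i => a + d * i) n).
  move=> r_step; apply/(sortedP 0) => i; rewrite size_mkseq => lt_i.
  by rewrite !nth_mkseq //; lia.
have -> : det_index A d =
          sorted (fun x y => y == x + d) (mkseq (fun i => a + d * i) n).
  rewrite /det_index; congr (is_true (sorted _ _)).
  apply: (sorted_eq leq_trans anti_leq).
  - exact: (sort_sorted leq_total).
  - by apply: sorted_terms => i; lia.
  apply: uniq_perm.
  - by rewrite sort_uniq fset_uniq.
  - rewrite map_inj_in_uniq ?iota_uniq // => i j.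
    by rewrite !mem_iota; nia.
  move=> x; rewrite mem_sort; apply/idP/mapP => [/A_prog|] [i].
    by move=> lt_i ->; exists i; rewrite ?mem_iota.
  by rewrite mem_iota => lt_i ->; apply/A_prog; exists i.
by apply: sorted_terms => i; rewrite mulnS; lia.
Qed.

Lemma det_index_card_le1 A d : #|` A| <= 1 -> det_index A d.
Proof.
by rewrite /det_index -(size_sort leq); case: (sort leq A) => [|x [|y s]].
Qed.

Lemma in_sumset {A B a d m b e n x} :
    progression A a d m -> progression B b e n ->
  x \in sumset A B <->
  exists i j, [/\ i < m, j < n & x = a + b + d * i + e * j].
Proof.
move=> A_prog B_prog; split=> [/imfset2P/=|].
  case=> y /A_prog[i lt_i ->] [z /B_prog[j lt_j ->] ->].
  by exists i, j; split=> //; lia.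
case=> i [j [lt_i lt_j ->]]; apply/imfset2P => /=.
exists (a + d * i); first by apply/A_prog; exists i.
exists (b + e * j); first by apply/B_prog; exists j.
lia.
Qed.

Lemma sumsetC A B : sumset A B = sumset B A.
Proof.
by apply/fsetP=> x; apply/imfset2P/imfset2P => /= -[y Ay [z Bz ->]];
  exists z => //; exists y; rewrite // addnC.
Qed.

Lemma AP_sumset_multiple A B d k :
    det_index A d -> det_index B (k * d) -> k <= #|` A| ->
  AP_set (sumset A B).
Proof.
move=> A_d B_kd le_k.
have [a A_prog] := det_index_progression A_d.
have [b B_prog] := det_index_progression B_kd.
have d_A := det_index_gt0 A_d; have d_B := det_index_gt0 B_kd.
move: {A_d B_kd} #|` A| #|` B| le_k d_A d_B A_prog B_prog => m n.
move=> le_k d_A d_B A_prog B_prog; exists d.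
have [n0|n_gt0] := posnP n.
  apply: (progression_det_index _ 0 _ 0); first by right.
  move=> x; rewrite (in_sumset A_prog B_prog); split.
    by case=> i [j []]; rewrite n0.
  by case.
(* The largest index is [(m - 1) + k * (n - 1)]. If [d = 0], both sets have at most one element and
   so does this range. *)
apply: (progression_det_index _ (a + b) _ (m + k * n.-1)).
  have [d0|] := posnP d; last by left.
  right; move: d_A d_B; rewrite d0 muln0 => d_A d_B.
  have -> : n.-1 = 0 by lia.
  by lia.
move=> x; rewrite (in_sumset A_prog B_prog); split.
  case=> i [j [lt_i lt_j ->]]; exists (i + k * j); last by lia.
  by have := leq_mul (leqnn k) (_ : j <= n.-1); lia.
case=> t lt_t ->.
have [k0|k_gt0] := posnP k.
  by exists t, 0; split=> //; lia.
(* Division by [k] leaves a remainder below [k <= m], a valid index [i]. If the quotient is too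
   large for [j], take [j = n - 1]; the excess is still below [m]. *)
have [le_tk|lt_kt] := leqP (t %/ k) n.-1.
  exists (t %% k), (t %/ k); split; first 2 [lia].
  - by have := ltn_pmod t k_gt0; lia.
  - by have := divn_eq t k; nia.
have le_kt : k * n.-1 <= t.
  by rewrite mulnC -leq_divRL // ltnW.
by exists (t - k * n.-1), n.-1; split; nia.
Qed.

Lemma AP_sumset_dvd {A B d e} :
    det_index A d -> det_index B e -> 1 < #|` A| -> 1 < #|` B| -> d <= e ->
    AP_set (sumset A B) ->
  exists k, [/\ 0 < k, k <= #|` A| & e = k * d].
Proof.
move=> A_d B_e m_gt1 n_gt1 le_de [c S_c].
have d_gt0 := det_index_gt0 A_d m_gt1.
have [a A_prog] := det_index_progression A_d.
have [b B_prog] := det_index_progression B_e.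
have [s S_prog] := det_index_progression S_c.
move: #|` A| #|` B| #|` sumset A B| m_gt1 n_gt1 A_prog B_prog S_prog => m n l.
move=> m_gt1 n_gt1 A_prog B_prog S_prog.
have S_in i j : i < m -> j < n ->
    exists2 t, t < l & a + b + d * i + e * j = s + c * t.
  move=> lt_i lt_j; apply/S_prog/(in_sumset A_prog B_prog).
  by exists i, j.
have S_out t : t < l -> exists i j,
    [/\ i < m, j < n & s + c * t = a + b + d * i + e * j].
  move=> lt_t; apply/(in_sumset A_prog B_prog)/S_prog.
  by exists t.
have [t0 lt_t0 def_t0] := S_in 0 0 ltac:(lia) ltac:(lia).
have [t1 lt_t1 def_t1] := S_in 1 0 ltac:(lia) ltac:(lia).
have [te lt_te def_te] := S_in 0 1 ltac:(lia) ltac:(lia).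
have [i0 [j0 [_ _ def_s]]] := S_out 0 ltac:(lia).
(* Both are the least element of the sumset. *)
have sE : s = a + b by nia.
have l_gt1 : 1 < l by nia.
have [i1 [j1 [_ _ def_c]]] := S_out 1 l_gt1.
have c_t1 : c * t1 = d by lia.
have /andP[c_gt0 t1_gt0] : (0 < c) && (0 < t1) by rewrite -muln_gt0 c_t1.
have le_cd : c <= d by rewrite -c_t1 leq_pmulr.
(* The second term gives [c = d * i1 + e * j1]; as [c > 0], some coefficient is positive, and
   [d <= e]. *)
have le_dc : d <= c.
  have {}def_c : c = d * i1 + e * j1 by lia.
  case: i1 def_c => [|i1] def_c; last by rewrite def_c mulnS; lia.
  case: j1 def_c => [|j1] def_c; first by lia.
  by rewrite def_c mulnS; lia.
have cE : c = d by lia.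
rewrite {}sE {}cE {def_s def_c c_gt0 c_t1 le_cd le_dc} in S_out def_te.
have eE : e = te * d by lia.
exists te; split=> //; first by nia.
(* If [m < te], the sumset contains [a + b + d * m]. But [j = 0] would need [i = m], and [j >= 1]
   already contributes [te * d > m * d]. *)
have [//|lt_m] := leqP te m.
have [i [j [lt_i lt_j def_m]]] := S_out m ltac:(lia).
by case: j lt_j def_m => [|j] _; nia.
Qed.

End ArithmeticProgressions.

Lemma index_multiple_AP_edge (G : graph) (f : G -> {fset nat}) (u v : G) :
  index_multiple f u v -> AP_set (edge_label f u v).
Proof.
case=> du [dv [k [f_u f_v _ le_k def_dv]]].
by apply: (AP_sumset_multiple _ _ du k); rewrite -?def_dv.
Qed.

Lemma index_multiple_card_le1 {G : graph} {f : G -> {fset nat}} {u v : G} :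
    #|` f v| <= 1 -> 0 < #|` f u| -> AP_set (f u) -> index_multiple f u v.
Proof.
move=> v_le1 u_gt0 [d f_u]; exists d, d, 1; split=> //; last by rewrite mul1n.
exact: det_index_card_le1.
Qed.

Theorem theorem2p8 (G : graph) (f : G -> {fset nat}) :
  vertex_arithmetic_IASI f ->
  (arithmetic_IASI f <->
   forall u v : G, adj u v -> index_multiple f u v \/ index_multiple f v u).
Proof.
move=> f_vert; have [f_IASI AP_f] := f_vert; split; last first.
  move=> f_mult; split=> //; split=> // u v /f_mult[] /index_multiple_AP_edge //.
  by rewrite /edge_label sumsetC.
case=> _ [_ AP_edge] u v adj_uv.
(* By injectivity, two adjacent vertices cannot both have the empty label. *)
have some_gt0 : 0 < #|` f u| \/ 0 < #|` f v|.
  have [/cardfs0_eq fu0|] := posnP #|` f u|; last by left.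
  have [/cardfs0_eq fv0|] := posnP #|` f v|; last by right.
  have [f_inj _] := f_IASI.
  by move: adj_uv; rewrite (f_inj u v) ?adj_irrefl // fu0 fv0.
have [u_le1|u_gt1] := leqP #|` f u| 1.
  have [v0|v_gt0] := posnP #|` f v|.
    by left; apply: index_multiple_card_le1; rewrite ?v0 //; case: some_gt0; lia.
  by right; apply: index_multiple_card_le1.
have [v_le1|v_gt1] := leqP #|` f v| 1.
  by left; apply: index_multiple_card_le1; rewrite // ltnW.
have [du f_u] := AP_f u; have [dv f_v] := AP_f v.
have AP_uv := AP_edge u v adj_uv.
have [le_uv|/ltnW le_vu] := leqP du dv.
  have [k [k_gt0 le_k def_dv]] :=
    AP_sumset_dvd f_u f_v u_gt1 v_gt1 le_uv AP_uv.
  by left; exists du, dv, k.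
rewrite /edge_label sumsetC in AP_uv.
have [k [k_gt0 le_k def_du]] :=
    AP_sumset_dvd f_v f_u v_gt1 u_gt1 le_vu AP_uv.
by right; exists dv, du, k.
Qed.
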